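(* Let $n\geq1$, let $d$ be a divisor of $n$ and let $H$ be an irreducible subgroup of $SL(n,\mathbb{C})$. Then $Z_d(H)$ is abelian, its exponent divides $\mathrm{lcm}(n/d,d)$, and its order divides $n^3/d$. If moreover $\gcd(n/d,d)=1$, then the order of $Z_d(H)$ divides $nd$.
   Context: Let $\xi=e^{2\pi i/n}$; the center of $SL(n,\mathbb{C})$ is $\langle\xi I_n\rangle$. For a divisor $d$ of $n$, $\pi_d:SL(n,\mathbb{C})\to SL(n,\mathbb{C})/\langle \xi^{n/d}I_n\rangle$ is the quotient map. A subgroup of $SL(n,\mathbb{C})$ is irreducible if no nonzero proper subspace of $\mathbb{C}^n$ is invariant. $Z_d(H)$ denotes the centralizer of $\pi_d(H)$ in $\pi_d(SL(n,\mathbb{C}))$. *)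

(* Defs.v *)
(* The complex numbers are modelled by an arbitrary
   numClosedFieldType C (algebraically closed, characteristic 0). *)
From HB Require Import structures.
From mathcomp Require Import all_boot all_order all_algebra.
Set Implicit Arguments. Unset Strict Implicit. Unset Printing Implicit Defensive.
Import Order.TTheory GRing.Theory Num.Theory.
Local Open Scope ring_scope.

Section Defs.
Variables (C : numClosedFieldType) (n : nat).

Definition inSL (g : 'M[C]_n) : Prop := \det g = 1.

Definition is_subgroup_SL (H : 'M[C]_n -> Prop) : Prop :=
  [/\ H 1%:M,
      (forall g, H g -> inSL g),
      (forall g h, H g -> H h -> H (g *m h)) &
      (forall g, H g -> H (invmx g))].

(* H is irreducible: every H-invariant subspace of C^n is 0 or C^n.
   Subspaces are row spaces of matrices U (rows = vectors of C^n written as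
   rows); the column vector v is sent to g v, i.e. the row v^T to v^T g^T. *)
Definition irreducible_SL (H : 'M[C]_n -> Prop) : Prop :=
  forall U : 'M[C]_n,
    (forall g, H g -> (U *m g^T <= U)%MS) -> U = 0 \/ row_full U.

(* z is in < xi^(n/d) I >, i.e. z is a scalar d-th root of unity (d %| n) *)
Definition in_mu (d : nat) (z : 'M[C]_n) : Prop :=
  exists c : C, c ^+ d = 1 /\ z = c%:M.

(* pi_d g = pi_d g' *)
Definition eq_mod_mu (d : nat) (g g' : 'M[C]_n) : Prop :=
  exists c : C, c ^+ d = 1 /\ g = c *: g'.

(* g in SL(n,C) with pi_d g in Z_d(H): pi_d g commutes with every pi_d h *)
Definition in_Zd (d : nat) (H : 'M[C]_n -> Prop) (g : 'M[C]_n) : Prop :=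
  inSL g /\
  forall h, H h -> in_mu d (g *m h *m invmx g *m invmx h).

(* Z_d(H) = { pi_d g | in_Zd d H g } is finite of order m: the sequence s
   lists exactly one representative of each element of Z_d(H). *)
Definition Zd_order (d : nat) (H : 'M[C]_n -> Prop) (m : nat) : Prop :=
  exists s : seq 'M[C]_n,
    [/\ size s = m,
        (forall g, g \in s -> in_Zd d H g),
        (forall i j, (i < size s)%N -> (j < size s)%N ->
           eq_mod_mu d (nth 0 s i) (nth 0 s j) -> i = j) &
        (forall g, in_Zd d H g -> exists2 x, x \in s & eq_mod_mu d g x)].

Definition Zd_abelian (d : nat) (H : 'M[C]_n -> Prop) : Prop :=
  forall g g', in_Zd d H g -> in_Zd d H g' -> eq_mod_mu d (g *m g') (g' *m g).

Definition Zd_exponent_dvd (d : nat) (H : 'M[C]_n -> Prop) (e : nat) : Prop :=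
  forall g, in_Zd d H g -> eq_mod_mu d (g ^+ e) 1%:M.

End Defs.

(* Main.v *)
(* For g in the preimage of Z_d(H), h |-> g h g^-1 h^-1 is a character of H with
   values in the d-th roots of unity, and by Schur's lemma it determines g up to
   an n-th root of unity.  Hence Z_d(H) is an extension of a finite group A of
   such characters by a cyclic group of order n/d, and lifting A to matrices
   gives a projective representation of degree n whose matrices at the
   nontrivial elements have trace 0.

   Order: commutators define an alternating pairing c on A.  If B is a maximal
   isotropic subgroup with radical part R = {b in B | c(A, b) = 1}, evaluating
   the sum of c(a, b) over A x B in both orders gives |B|^2 = |R| |A|; and |B|
   divides n, because n/|B| is the trace of an idempotent.  So |A| divides n^2.
   As A embeds in a power of Z/d, it also has order prime to n/d when n/d and d
   are coprime, and then |A| divides d^2.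

   Exponent: if the character of g has order k, then g^k = v is scalar and the
   characteristic polynomial of g is invariant under X |-> c X for all values c
   of the character, hence equals (X^k - v)^(n/k); now det g = 1 gives
   v^(n/k) = (-1)^(n + n/k), and a parity count finishes. *)
Require Import Defs.
From HB Require Import structures.
From mathcomp Require Import all_boot all_order all_algebra all_fingroup.
From mathcomp Require Import spectral cyclic separable cyclotomic.
From Stdlib Require Import Classical.
Import Order.TTheory GRing.Theory Num.Theory.
Local Open Scope ring_scope.

(** * Roots of unity, idempotents and character sums *)

Lemma prim_root_exists (C : numClosedFieldType) n :
  (0 < n)%N -> exists z : C, n.-primitive_root z.
Proof.
move=> n_gt0; have [rs] := closed_field_poly_normal ('X^n - 1 : {poly C}).
rewrite (monicP (monicXnsubC _ n_gt0)) scale1r => Ers.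
(* In characteristic 0, ['X^n - 1] is separable, and [n] distinct roots of it always include a
   primitive one. *)
suff /hasP[z _ zP] : has n.-primitive_root rs by exists z.
apply: has_prim_root => //.
- by apply/allP => z; rewrite -root_prod_XsubC -Ers.
- by rewrite -separable_prod_XsubC -Ers separable_Xn_sub_1 // pnatr_eq0 -lt0n.
- by rewrite -ltnS -(size_prod_XsubC rs id) -Ers size_XnsubC.
Qed.

Lemma unitmx_neq0 (F : fieldType) n (A : 'M[F]_n) :
  (0 < n)%N -> A \in unitmx -> A != 0.
Proof.
move=> n_gt0 uA; rewrite -mxrank_eq0 mxrank_unit // -lt0n; exact: n_gt0.
Qed.

Lemma scaler_cancel (F : fieldType) (V : lmodType F) (a b : F) (v : V) :
  v != 0 -> a *: v = b *: v -> a = b.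
Proof.
move=> v0 /eqP; rewrite -subr_eq0 -scalerBl scaler_eq0 (negbTE v0) orbF.
by rewrite subr_eq0 => /eqP.
Qed.

(** Factor [E = L *m R] through its rank; idempotence forces [R *m L = 1], and the trace is
    invariant under swapping the factors. *)
Lemma mxtrace_idem (F : fieldType) n (E : 'M[F]_n) :
  E *m E = E -> \tr E = (\rank E)%:R.
Proof.
have := mulmx_base E; move: (row_base_free E) (col_base_full E).
move: (col_base E) (row_base E) => L R Rfree Lfull EL EE.
have LRLR : L *m R *m (L *m R) = L *m R by rewrite EL.
have E1 : R *m L = 1%:M.
  apply: (row_free_inj Rfree); apply: (row_full_inj Lfull).
  by rewrite /= mul1mx -LRLR !mulmxA.
by rewrite -{1}EL mxtrace_mulC E1 mxtrace1.
Qed.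

(** If [f b] differs from 1, translation by [b] shows that the sum equals [f b] times itself, so it
    vanishes. *)
Lemma sum_mult_char (F : fieldType) (gT : finGroupType) (A : {group gT})
    (f : gT -> F) :
  {in A &, forall a b, f (a * b)%g = f a * f b} ->
  \sum_(a in A) f a = if [forall a in A, f a == 1] then #|A|%:R else 0.
Proof.
move=> fM; case: ifPn => [/forall_inP f1 | ].
  by rewrite (eq_bigr (fun=> 1)) ?sumr_const // => a /f1 /eqP.
case/forall_inPn => b bA fb; apply/eqP.
have: f b * (\sum_(a in A) f a) = \sum_(a in A) f a.
  rewrite mulr_sumr [RHS](reindex_inj (mulgI b)) /=.
  rewrite [RHS](eq_bigl (mem A)); last by move=> a; rewrite /= groupMl.
  by apply: eq_bigr => a aA; rewrite fM.
move/eqP; rewrite -subr_eq0 -[X in _ - X]mul1r -mulrBl mulf_eq0 subr_eq0.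
by rewrite (negbTE fb).
Qed.

(** * Projective representations with trace zero off the identity *)

Section ProjectiveRepresentation.

Variables (C : numClosedFieldType) (n : nat) (gT : finGroupType).
Variable (s : gT -> 'M[C]_n).
Hypothesis n_gt0 : (0 < n)%N.

Definition proj_repr (A : {set gT}) : Prop :=
  [/\ {in A, forall a, s a \in unitmx},
      {in A &, forall a b, exists l, s (a * b)%g = l *: (s a *m s b)} &
      {in A, forall a, a != 1%g -> \tr (s a) = 0}].

Lemma proj_repr_sub (A B : {set gT}) :
  B \subset A -> proj_repr A -> proj_repr B.
Proof.
move=> /subsetP sBA [uA mA tA]; split=> [a /sBA|a b /sBA aA /sBA|a /sBA].
- exact: uA.
- exact: mA.
- exact: tA.
Qed.

Lemma proj_repr1 (A : {group gT}) : proj_repr A -> exists l, s 1%g = l%:M.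
Proof.
case=> uA mA _; have [l] := mA 1%g 1%g (group1 A) (group1 A).
rewrite mulg1 => /(congr1 (mulmx^~ (invmx (s 1%g)))).
rewrite mulmxV ?uA // -scalemxAl mulmxK ?uA // => E.
have l0 : l != 0.
  apply/eqP => l0; move: E; rewrite l0 scale0r => /eqP.
  by rewrite -mxrank_eq0 mxrank1 -[_ == _]negbK -lt0n n_gt0.
exists l^-1; by rewrite -(scalerK l0 (s 1%g)) -E scalemx1.
Qed.

(* Rescaling by the eigenvalues on a common eigenvector turns s into an honest
   representation of B; the average over B is an idempotent of trace n/|B|. *)
Lemma commuting_card_dvd (B : {group gT}) :
  proj_repr B -> {in B &, forall a b, s a *m s b = s b *m s a} ->
  (#|B| %| n)%N.
Proof.
move=> pB cB; have [l1 s1] := proj_repr1 _ pB; case: pB => uB mB tB.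
have [v v0 /allP vs] : exists2 v : 'rV[C]_n,
    v != 0 & all (fun A => stablemx v A) [seq s a | a in B].
  apply: common_eigenvector => // _ _ /mapP[a aB ->] /mapP[b bB ->].
  by apply: cB; rewrite -mem_enum.
have /fin_all_exists [p pP] (a : gT) : exists c, a \in B -> v *m s a = c *: v.
  case aB: (a \in B); last by exists 0.
  have /vs/sub_rVP[c Ec] : s a \in [seq s a | a in B] by apply: image_f.
  by exists c.
have p0 a : a \in B -> p a != 0.
  move=> aB; apply: contraNneq v0 => pa.
  by rewrite -(mulmxK (uB _ aB) v) pP // pa scale0r mul0mx.
pose t a := (p a)^-1 *: s a.
have tM : {in B &, forall a b, t (a * b)%g = t a *m t b}.
  move=> a b aB bB; have [l El] := mB a b aB bB.
  (* Evaluating on the common eigenvector [v] identifies the cocycle value [l], which the rescaling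
     by [p] then absorbs. *)
  have : v *m s (a * b)%g = (l * (p a * p b)) *: v.
    by rewrite El -scalemxAr mulmxA pP // -scalemxAl pP // !scalerA mulrA.
  rewrite pP ?groupM // => /(scaler_cancel _ _ _ _ _ v0) pab.
  have l0 : l != 0.
    by have := p0 _ (groupM aB bB); rewrite pab mulf_eq0 => /norP[].
  rewrite /t El pab -scalemxAl -scalemxAr !scalerA; congr (_ *: _).
  by rewrite !invfM mulrAC mulVf // mul1r.
have t1 : t 1%g = 1%:M.
  have := pP _ (group1 B); rewrite /t s1 mul_mx_scalar.
  move/(scaler_cancel _ _ _ _ _ v0) => l1E.
  by rewrite -[l1%:M]scalemx1 scalerA l1E mulVf ?scale1r // p0.
have B0 : #|B|%:R != 0 :> C by rewrite pnatr_eq0 -lt0n cardG_gt0.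
pose S := \sum_(b in B) t b; pose E := #|B|%:R^-1 *: S.
have tS a : a \in B -> t a *m S = S.
  move=> aB; rewrite /S mulmx_sumr [RHS](reindex_inj (mulgI a)) /=.
  rewrite [RHS](eq_bigl (mem B)); last by move=> b; rewrite /= groupMl.
  by apply: eq_bigr => b bB; rewrite tM.
have EE : E *m E = E.
  rewrite /E -scalemxAl -scalemxAr {1}/S mulmx_suml.
  rewrite (eq_bigr (fun=> S)) => [|a /tS//].
  by rewrite sumr_const -scaler_nat scalerK.
have := mxtrace_idem _ _ _ EE.
(* Only the identity contributes to the trace, so $n/|B|$ is the rank of [E], a natural number. *)
rewrite /E mxtraceZ raddf_sum (bigD1 1%g) //= t1 mxtrace1 big1 => [|a].
  rewrite addr0 -/S -/E => /(congr1 ( *%R #|B|%:R)).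
  rewrite mulVKf // -natrM => /eqP; rewrite eqr_nat => /eqP {1}->.
  exact: dvdn_mulr.
by case/andP => aB a1; rewrite mxtraceZ tB ?mulr0.
Qed.

Lemma proj_repr_card_dvd (A : {group gT}) :
  proj_repr A ->
  {in A &, forall a b, exists c, s a *m s b = c *: (s b *m s a)} ->
  (#|A| %| n ^ 2)%N.
Proof.
move=> pA cA; have [uA mA tA] := pA.
(* Finite choice makes the commutator scalar a total function on pairs, with junk value 0 outside
   [A]. *)
have /fin_all_exists [f fP] (x : gT * gT) : exists k, x.1 \in A -> x.2 \in A ->
    s x.1 *m s x.2 = k *: (s x.2 *m s x.1).
  case: x => a b /=; case aA: (a \in A); last by exists 0.
  by case bA: (b \in A); [have [c Ec] := cA a b aA bA; exists c | exists 0].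
pose c a b := f (a, b).
have cP a b : a \in A -> b \in A -> s a *m s b = c a b *: (s b *m s a).
  exact: (fP (a, b)).
have sab0 a b : a \in A -> b \in A -> s a *m s b != 0.
  by move=> aA bA; rewrite unitmx_neq0 // unitmx_mul !uA.
have cMl a a' b : a \in A -> a' \in A -> b \in A ->
    c (a * a')%g b = c a b * c a' b.
  move=> aA a'A bA; have [l El] := mA a a' aA a'A.
  apply: (scaler_cancel _ _ _ _ _ (sab0 _ _ bA (groupM aA a'A))).
  rewrite -cP ?groupM // El -scalemxAl -mulmxA (cP a' b) // -scalemxAr mulmxA.
  rewrite (cP a b) // -scalemxAl -mulmxA -scalemxAr !scalerA.
  by congr (_ *: _); rewrite mulrC [c a b * _]mulrC.
have cC a b : a \in A -> b \in A -> c a b * c b a = 1.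
  move=> aA bA; apply: (scaler_cancel _ _ _ _ _ (sab0 _ _ aA bA)).
  by rewrite scale1r -scalerA -cP // -cP.
have cC1 a b : a \in A -> b \in A -> (c a b == 1) = (c b a == 1).
  move=> aA bA; have := cC a b aA bA => cab.
  by apply/eqP/eqP => E; move: cab; rewrite E ?mul1r ?mulr1.
have cMr a b b' : a \in A -> b \in A -> b' \in A ->
    c a (b * b')%g = c a b * c a b'.
  move=> aA bA b'A; have bbA := groupM bA b'A.
  have c0 x : x \in A -> c x a != 0.
    move=> xA; apply: contraTneq (oner_neq0 C) => c0.
    by rewrite -(cC x a) // c0 mul0r eqxx.
  have cV x : x \in A -> c a x = (c x a)^-1.
    by move=> xA; apply: (mulIf (c0 x xA)); rewrite cC // mulVf // c0.
  by rewrite !cV // cMl // invfM.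
(* Being a subgroup, [perp x] contains a generated group as soon as it contains the generators. *)
pose perp x := [set a in A | c a x == 1].
have perpG x : x \in A -> group_set (perp x).
  move=> xA; apply/group_setP; split=> [|a b].
    rewrite inE group1 /=; have := cMl 1%g 1%g x (group1 A) (group1 A) xA.
    rewrite mulg1 => /eqP; rewrite -subr_eq0 -{1}[c _ _]mulr1 -mulrBr mulf_eq0.
    rewrite subr_eq0 [1 == _]eq_sym => /orP[/eqP c0|//].
    by have := cC 1%g x (group1 A) xA; rewrite c0 mul0r => /esym/eqP; rewrite oner_eq0.
  rewrite !inE => /andP[aA /eqP ca] /andP[bA /eqP cb].
  by rewrite groupM //= cMl // ca cb mulr1.
pose isotropic (B : {group gT}) :=
  (B \subset A) && [forall a in B, forall b in B, c a b == 1].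
have caa a : a \in A -> c a a = 1.
  move=> aA; apply: (scaler_cancel _ _ _ _ _ (sab0 _ _ aA aA)).
  by rewrite -cP // scale1r.
have iso1 : isotropic 1%G.
  rewrite /isotropic sub1G; apply/forall_inP => a /set1P->.
  by apply/forall_inP => b /set1P->; rewrite caa.
have [B /maxgroupP[/andP[sBA /forall_inP isoB] maxB] _] := maxgroup_exists iso1.
have isoB1 a b : a \in B -> b \in B -> c a b = 1.
  by move=> aB bB; apply/eqP; move: b bB; apply/forall_inP; apply: isoB.
have BA := subsetP sBA.
(* By maximality [B] is its own orthogonal: if [a] is orthogonal to [B], the group generated by [a]
   and [B] is still isotropic. Orthogonality spreads from generators to [K] in one argument ([gK]),
   then in both ([KK]). *)
have perpB a : a \in A -> (forall b, b \in B -> c a b = 1) -> a \in B.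
  move=> aA aB; pose K := <<a |: B>>%G.
  have gA : a |: B \subset A by rewrite subUset sub1set aA.
  have gg x y : x \in a |: B -> y \in a |: B -> c x y == 1.
    case/setU1P => [->|xB] /setU1P[->|yB]; first by rewrite caa.
    - by rewrite aB.
    - by rewrite cC1 ?aB // BA.
    - by rewrite isoB1.
  have sKA : K \subset A by rewrite gen_subG.
  have KA := subsetP sKA.
  have gK x y : x \in a |: B -> y \in K -> c y x == 1.
    move=> xg yK; have xA := subsetP gA _ xg.
    suff /subsetP/(_ y yK) : K \subset Group (perpG x xA).
      by rewrite inE => /andP[].
    rewrite gen_subG; apply/subsetP => w wg; rewrite inE gg // andbT.
    exact: (subsetP gA).
  have KK x y : x \in K -> y \in K -> c y x == 1.
    move=> xK yK; have xA := KA _ xK.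
    suff /subsetP/(_ y yK) : K \subset Group (perpG x xA).
      by rewrite inE => /andP[].
    rewrite gen_subG; apply/subsetP => w wg.
    rewrite inE (subsetP gA _ wg) /= cC1 ?gK //.
    exact: (subsetP gA).
  rewrite -(maxB K).
  - by rewrite mem_gen ?setU11.
  - rewrite /isotropic sKA; apply/forall_inP => x xK; apply/forall_inP => y yK.
    exact: KK.
  - by rewrite sub_gen ?subsetUr.
have dvdB : (#|B| %| n)%N.
  apply: commuting_card_dvd (proj_repr_sub _ _ sBA pA) _ => a b aB bB.
  by rewrite cP ?BA // isoB1 // scale1r.
pose R := [set b in B | [forall a in A, c a b == 1]].
(* Double counting: the inner sum over [B] survives only for [a] in [B], the inner sum over [A] only
   for [b] in [R]. *)
have : (#|B| * #|B|)%:R = (#|R| * #|A|)%:R :> C.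
  transitivity (\sum_(a in A) \sum_(b in B) c a b).
    rewrite (eq_bigr (fun a => if a \in B then #|B|%:R else 0)) => [|a aA].
      rewrite -big_mkcondr /= (eq_bigl (mem B)) => [|a].
        by rewrite sumr_const natrM mulr_natr.
      by case aB: (a \in B); rewrite ?andbF // BA.
    rewrite sum_mult_char => [|b b' bB b'B]; last by apply: cMr => //; apply: BA.
    congr (if _ then _ else _); apply/forall_inP/idP => [H|aB b bB].
      by apply: perpB => // b /H/eqP.
    by rewrite isoB1.
  rewrite exchange_big /=.
  rewrite (eq_bigr (fun b => if [forall a in A, c a b == 1] then #|A|%:R else 0)).
    rewrite -big_mkcondr /= (eq_bigl (fun b => b \in R)) => [|b]; last by rewrite inE.
    by rewrite sumr_const natrM mulr_natl.
  by move=> b bB; rewrite sum_mult_char // => a a' aA a'A; apply: cMl => //; apply: BA.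
move/eqP; rewrite eqr_nat => /eqP E.
rewrite (@dvdn_trans (#|B| * #|B|)) ?dvdn_mul // E; exact: dvdn_mull.
Qed.

End ProjectiveRepresentation.

(** * Characteristic polynomials, determinants and parity *)

Lemma coef_comp_scaleX (R : comNzRingType) (p : {poly R}) (c : R) i :
  (p \Po (c *: 'X))`_i = c ^+ i * p`_i.
Proof.
rewrite comp_polyE coef_sum.
under eq_bigr => k _ do rewrite exprZn !coefZ coefXn.
have [lti|lei] := ltnP i (size p); last first.
  rewrite nth_default // mulr0 big1 // => k _.
  by rewrite gtn_eqF ?mulr0 // (leq_trans (ltn_ord k)).
rewrite (bigD1 (Ordinal lti)) //= eqxx mulr1 mulrC big1 ?addr0 // => k.
by rewrite -val_eqE /= eq_sym => /negbTE->; rewrite !mulr0.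
Qed.

(** Over polynomials $(cX - g)h = c\,h(X - g)$; take determinants and cancel $\det h$. *)
Lemma comp_char_poly_twist (F : fieldType) n (g h : 'M[F]_n) (c : F) :
  h \in unitmx -> g *m h = c *: (h *m g) ->
  char_poly g \Po (c *: 'X) = c ^+ n *: char_poly g.
Proof.
move=> uh gh; have hP0 : \det (map_mx polyC h) != 0.
  by rewrite det_map_mx polyC_eq0 -unitfE.
apply: (mulIf hP0); rewrite /char_poly -det_map_mx -det_mulmx.
suff -> : map_mx (comp_poly (c *: 'X)) (char_poly_mx g) *m map_mx polyC h
    = c%:P *: (map_mx polyC h *m char_poly_mx g).
  by rewrite detZ det_mulmx -polyC_exp mul_polyC -scalerAl mulrC.
rewrite /char_poly_mx map_mxB map_scalar_mx /= comp_polyX.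
have -> : map_mx (comp_poly (c *: 'X)) (map_mx polyC g) = map_mx polyC g.
  by apply/matrixP => i j; rewrite !mxE comp_polyC.
rewrite mulmxBl mulmxBr scalerBr -map_mxM gh map_mxZ map_mxM.
by rewrite mul_scalar_mx mul_mx_scalar scalerA mul_polyC.
Qed.

Lemma char_poly_coef_twist (F : fieldType) n (g h : 'M[F]_n) (c : F) j :
  g \in unitmx -> h \in unitmx -> g *m h = c *: (h *m g) ->
  (char_poly g)`_j != 0 -> c ^+ j = 1.
Proof.
move=> ug uh gh pj; have E := comp_char_poly_twist _ _ _ _ _ uh gh.
have Ei i : (c ^+ i - c ^+ n) * (char_poly g)`_i = 0.
  have := congr1 (fun p : {poly F} => p`_i) E.
  by rewrite coef_comp_scaleX coefZ mulrBl => ->; rewrite subrr.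
(* The constant coefficient is $\pm\det g$, hence nonzero, so comparison in degree 0 gives $c^n =
   1$. *)
have cn : c ^+ n = 1.
  apply/eqP; have := Ei 0%N; rewrite expr0 => /eqP; rewrite mulf_eq0 subr_eq0.
  case/orP => [/eqP<- //|]; rewrite char_poly_det mulf_eq0 signr_eq0 /=.
  by move: ug; rewrite unitmxE unitfE => /negbTE->.
by move/eqP: (Ei j); rewrite mulf_eq0 (negbTE pj) orbF cn subr_eq0 => /eqP.
Qed.

Lemma det_of_scalar_power (C : numClosedFieldType) n (g : 'M[C]_n) k v :
  (0 < k)%N -> g ^+ k = v%:M ->
  (forall j, (char_poly g)`_j != 0 -> (k %| j)%N) ->
  (k %| n)%N /\ (-1) ^+ n * \det g = (- v) ^+ (n %/ k).
Proof.
move=> k0 gk pk; set p := char_poly g in pk.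
have pn : p`_n = 1.
  have := monicP (char_poly_monic g); rewrite lead_coefE size_char_poly.
  by [].
have kn : (k %| n)%N by apply: pk; rewrite pn oner_neq0.
(* Only exponents divisible by [k] occur, so $p = q(X^k)$ with [q] monic of degree $n/k$. *)
split=> //; pose q := \poly_(j < (n %/ k).+1) p`_(j * k).
have pq : p = q \Po 'X^k.
  apply/polyP => i; rewrite coef_comp_poly_Xn // coef_poly.
  case: ifPn => [ki|]; last first.
    by apply: contraNeq => /pk.
  rewrite divnK // ltnS; case: ifPn => // ltni.
  rewrite nth_default // size_char_poly ltnNge; apply: contra ltni.
  exact: leq_div2r.
have qn : q`_(n %/ k) = 1 by rewrite coef_poly ltnSn divnK.
have sq : size q = (n %/ k).+1.
  by rewrite size_poly_eq //= divnK // pn oner_neq0.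
have lq : lead_coef q = 1 by rewrite lead_coefE sq.
have [rs Eq] := closed_field_poly_normal q; rewrite lq scale1r in Eq.
have rsE z : z \in rs -> z = v.
  move=> zrs; have /rootP qz : root q z by rewrite Eq root_prod_XsubC.
  (* A [k]-th root of a root of [q] is an eigenvalue of [g], so its [k]-th power is [v]. Thus $q =
     (X - v)^{n/k}$, and evaluation at 0 gives the determinant. *)
  pose t := k.-root z; have tk : t ^+ k = z by rewrite rootCK.
  have : eigenvalue g t.
    rewrite eigenvalue_root_char -/p pq; apply/rootP.
    by rewrite horner_comp hornerXn tk.
  case/eigenvalueP => x xg x0.
  have xgj j : x *m g ^+ j = t ^+ j *: x.
    elim: j => [|j IH]; first by rewrite !expr0 mulmx1 scale1r.
    by rewrite !exprS -[g * _]/(g *m _) mulmxA xg -scalemxAl IH scalerA.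
  have := xgj k; rewrite gk mul_mx_scalar tk => E.
  exact: esym (scaler_cancel _ _ _ _ _ x0 E).
have srs : size rs = (n %/ k)%N.
  by apply: succn_inj; rewrite -sq {1}Eq size_prod_XsubC.
rewrite -char_poly_det -/p pq -horner_coef0 horner_comp hornerXn expr0n.
rewrite gtn_eqF //= Eq horner_prod -srs.
rewrite (eq_big_seq (fun=> - v)) => [|z /rsE->].
  by rewrite big_const_seq count_predT -Monoid.iteropE.
by rewrite hornerXsubC sub0r.
Qed.

(** This is the exponent of $-1$ left over in the exponent bound. Were it odd, $n/k$ would be odd
    and [n] even; then $n/d$, the gcd and [d] would all be odd, contradicting $n = (n/d)d$. *)
Lemma lcm_parity n d k : (d %| n)%N -> (k %| d)%N -> (0 < n)%N ->
  ~~ odd ((n + n %/ k) * (d %/ gcdn (n %/ d) d)).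
Proof.
move=> dn kd n0; have kn := dvdn_trans kd dn.
have d0 : (0 < d)%N := dvdn_gt0 n0 dn.
have k0 : (0 < k)%N := dvdn_gt0 d0 kd.
rewrite oddM oddD; apply/negP => /andP[nk od].
have En := divnK dn; have Ek := divnK kn; have Ekd := divnK kd.
have Eg := divnK (dvdn_gcdr (n %/ d) d).
have onk : odd (n %/ k).
  by move: nk; rewrite -[in odd n]Ek oddM; case: odd.
have no : ~~ odd n by move: nk; rewrite onk addbT.
have Enk : (n %/ k = n %/ d * (d %/ k))%N by rewrite muln_divA // En.
have ond : odd (n %/ d) by move: onk; rewrite Enk oddM => /andP[].
have og : odd (gcdn (n %/ d) d).
  by move: ond; rewrite -{1}(divnK (dvdn_gcdl (n %/ d) d)) oddM => /andP[].
by move: no; rewrite -En oddM ond -Eg oddM od og.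
Qed.

(** While some vector satisfying [P] lies outside the span, adjoin it; [m] bounds the codimension,
    which drops each time. [P] is an arbitrary predicate, so the case split is classical. *)
Lemma finite_span (F : fieldType) (vT : vectType F) (P : vT -> Prop) :
  exists s : seq vT,
    (forall x, x \in s -> P x) /\ (forall x, P x -> x \in <<s>>%VS).
Proof.
suff H m (s : seq vT) : (\dim {:vT} - \dim <<s>> < m)%N ->
    (forall x, x \in s -> P x) ->
    exists s : seq vT,
    (forall x, x \in s -> P x) /\ (forall x, P x -> x \in <<s>>%VS).
  exact: (H _ [::] (ltnSn _)).
elim: m s => // m IH s sm sP.
have [sspan|] := classic (forall x, P x -> x \in <<s>>%VS); first by exists s.
move=> /not_all_ex_not [x nx]; have [Px /negP xs] := imply_to_and _ _ nx.
apply: (IH (x :: s)); last by move=> y /predU1P[->|/sP].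
have lt : (\dim <<s>> < \dim <<x :: s>>)%N.
  rewrite span_cons ltn_neqAle dimvS ?addvSr // andbT.
  rewrite (dimv_leqif_eq (addvSr _ _)); apply: contra xs => /eqP->.
  exact: subvP (addvSl _ _) _ (memv_line x).
move: sm; rewrite !ltnS; apply: leq_trans; rewrite ltn_sub2l //.
by apply: (leq_trans lt); rewrite dimvS ?subvf.
Qed.

(** * The preimage of $Z_d(H)$ and Schur's lemma *)

Section Centralizer.

Variables (C : numClosedFieldType) (n d' : nat) (H : 'M[C]_n -> Prop).
(** The successor form gives ['I_d] the additive group structure of $\mathbb{Z}/d$. *)
Local Notation d := d'.+1.
Hypotheses (n_gt0 : (0 < n)%N) (hH : is_subgroup_SL H).
Hypothesis hirr : irreducible_SL H.

Lemma inSL_unitmx (g : 'M[C]_n) : inSL g -> g \in unitmx.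
Proof. by rewrite unitmxE => ->; apply: unitr1. Qed.

Lemma H_inSL h : H h -> inSL h.
Proof. by case: hH => _ + _ _; apply. Qed.

Lemma in_ZdP (g : 'M[C]_n) : in_Zd d H g <->
  inSL g /\ forall h, H h -> exists c, c ^+ d = 1 /\ g *m h = c *: (h *m g).
Proof.
split=> -[gSL gH]; split=> // h Hh; have [c [cd E]] := gH h Hh; exists c.
  split=> //; have uh := inSL_unitmx _ (H_inSL _ Hh).
  have ug := inSL_unitmx _ gSL.
  have := congr1 (fun X => X *m h *m g) E.
  by rewrite /= mulmxKV // mulmxKV // mul_scalar_mx -scalemxAl.
split=> //; rewrite E -!scalemxAl mulmxK ?inSL_unitmx // mulmxV ?scalemx1 //.
exact: inSL_unitmx (H_inSL _ Hh).
Qed.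

Lemma in_Zd_mul (g g' : 'M[C]_n) :
  in_Zd d H g -> in_Zd d H g' -> in_Zd d H (g *m g').
Proof.
move=> /in_ZdP[gSL gH] /in_ZdP[g'SL g'H]; apply/in_ZdP; split.
  by rewrite /inSL det_mulmx gSL g'SL mulr1.
move=> h Hh; have [c [cd E]] := gH h Hh; have [c' [c'd E']] := g'H h Hh.
exists (c' * c); split; first by rewrite exprMn cd c'd mulr1.
by rewrite -mulmxA E' -scalemxAr (mulmxA g) E -scalemxAl scalerA mulmxA.
Qed.

Lemma in_Zd_scale (g : 'M[C]_n) c :
  c ^+ n = 1 -> in_Zd d H g -> in_Zd d H (c *: g).
Proof.
move=> cn /in_ZdP[gSL gH]; apply/in_ZdP; split.
  by rewrite /inSL detZ cn mul1r.
move=> h /gH [b [bd E]]; exists b; split=> //.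
by rewrite -scalemxAl E -scalemxAr !scalerA mulrC.
Qed.

Lemma in_Zd1 : in_Zd d H 1%:M.
Proof.
apply/in_ZdP; split; first exact: det1.
by move=> h _; exists 1; rewrite expr1n scale1r mulmx1 mul1mx.
Qed.

(** An eigenspace of [X^T] is nonzero and stable under every [h^T], hence everything; the transposes
    match the row convention of [irreducible_SL]. *)
Lemma schur (X : 'M[C]_n) : (forall h, H h -> X *m h = h *m X) ->
  exists l, X = l%:M.
Proof.
move=> XH; have [l lX] := eigenvalue_closed X^T n_gt0; exists l.
have [|U0|/row_fullP [V VU]] := hirr (eigenspace X^T l).
- move=> h /XH E; apply/eigenspaceP.
  by rewrite -mulmxA -trmx_mul E trmx_mul mulmxA (eigenspaceP (submx_refl _))
    -scalemxAl.
- by move: lX; rewrite /eigenvalue U0 eqxx.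
apply: trmx_inj; rewrite tr_scalar_mx -[LHS]mul1mx -VU -mulmxA.
by rewrite (eigenspaceP (submx_refl _)) -scalemxAr VU scalemx1.
Qed.

(** Commuting with [X] is a linear condition on [h], so a finite subset of [H] with the same span
    suffices, even for infinite [H]. *)
Lemma finite_test_set : exists r (hs : 'I_r -> 'M[C]_n),
  (forall i, H (hs i)) /\
  forall X, (forall i, X *m hs i = hs i *m X) ->
    forall h, H h -> X *m h = h *m X.
Proof.
have [s [sH Hs]] := finite_span _ _ H.
exists (size s), (fun i => s`_i); split=> [i|X Xs h /Hs hs].
  by apply: sH; apply: mem_nth.
rewrite (coord_span (X := in_tuple s) hs) mulmx_sumr mulmx_suml.
by apply: eq_bigr => i _; rewrite -scalemxAr -scalemxAl Xs.
Qed.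

(** * Characters attached to elements of $Z_d(H)$ *)

Variables (z : C) (r : nat) (hs : 'I_r -> 'M[C]_n).
Hypotheses (zP : d.-primitive_root z) (hsH : forall i, H (hs i)).
Hypothesis hs_test : forall X, (forall i, X *m hs i = hs i *m X) ->
  forall h, H h -> X *m h = h *m X.

Local Notation Ch := 'rV['I_d]_r.

(* The character h |-> g h g^-1 h^-1 of H attached to g in Z_d(H) takes values
   in the powers of z; it is recorded by its exponents on the h_i. *)
Definition has_char (a : Ch) (g : 'M[C]_n) :=
  forall i, g *m hs i = z ^+ a 0 i *: (hs i *m g).

Lemma has_char_exists g : in_Zd d H g -> exists a, has_char a g.
Proof.
case/in_ZdP => _ gH.
have /fin_all_exists [f fP] (i : 'I_r) :
    exists k : 'I_d, g *m hs i = z ^+ k *: (hs i *m g).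
  have [c [cd ->]] := gH _ (hsH i).
  by have [k ->] := prim_rootP zP cd; exists k.
by exists (\row_i f i) => i; rewrite mxE.
Qed.

Lemma has_charM a b g g' :
  has_char a g -> has_char b g' -> has_char (a * b)%g (g *m g').
Proof.
move=> ag bg i; rewrite -mulmxA bg -scalemxAr (mulmxA g) ag -scalemxAl scalerA.
by rewrite mulmxA FinRing.zmodMgE mxE /= prim_expr_mod // exprD mulrC.
Qed.

Lemma has_char1 : has_char 1%g 1%:M.
Proof. by move=> i; rewrite FinRing.zmod1gE mxE /= scale1r mulmx1 mul1mx. Qed.

Lemma has_charX a g k : has_char a g -> has_char (a ^+ k)%g (g ^+ k).
Proof.
move=> ag; elim: k => [|k IH]; first exact: has_char1.
by rewrite expgS exprS; apply: has_charM.
Qed.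

Lemma has_charZ a g c : has_char a g -> has_char a (c *: g).
Proof. by move=> ag i; rewrite -scalemxAl ag -scalemxAr !scalerA mulrC. Qed.

(** The quotient [invmx g' *m g] commutes with the test elements, so it is scalar by Schur;
    determinants make it an [n]-th root of unity. *)
Lemma same_char a g g' : inSL g -> inSL g' -> has_char a g -> has_char a g' ->
  exists2 c, c ^+ n = 1 & g = c *: g'.
Proof.
move=> gSL g'SL ag ag'; have ug' := inSL_unitmx _ g'SL.
have [c Ec] : exists c, invmx g' *m g = c%:M.
  apply/schur/hs_test => i; apply: (can_inj (mulKmx ug')).
  by rewrite !mulmxA mulmxV // mul1mx ag ag' -!scalemxAl mulmxK.
have E : g = c *: g' by rewrite -(mulKVmx ug' g) Ec mul_mx_scalar.
by exists c => //; move: gSL; rewrite /inSL E detZ g'SL mulr1.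
Qed.

Lemma has_char_unique a b g : inSL g -> has_char a g -> has_char b g -> a = b.
Proof.
move=> gSL ag bg; apply/rowP => i; apply/val_inj/eqP.
have := ag i; rewrite bg => /scaler_cancel E.
have {}E := E (unitmx_neq0 _ _ _ n_gt0 _).
have /E /eqP : hs i *m g \in unitmx.
  by rewrite unitmx_mul !inSL_unitmx //; apply: H_inSL.
by rewrite (eq_prim_root_expr zP) !modn_small // eq_sym.
Qed.

(** [A] is the image of $Z_d(H)$ in the finite group [Ch]; classical logic makes membership
    boolean. *)
Lemma char_group_exists : exists A : {group Ch},
  forall a, a \in A <-> exists2 g, in_Zd d H g & has_char a g.
Proof.
have /fin_all_exists [p pP] (a : Ch) : exists b : bool,
    b <-> exists2 g, in_Zd d H g & has_char a g.
  have [Ea|Ea] := classic (exists2 g, in_Zd d H g & has_char a g).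
    by exists true.
  by exists false; split.
have pG : group_set [set a | p a].
  apply/group_setP; split=> [|a b]; rewrite !inE.
    by apply/pP; exists 1%:M; [apply: in_Zd1 | apply: has_char1].
  move=> /pP[g Zg ag] /pP[g' Zg' bg']; apply/pP; exists (g *m g').
    exact: in_Zd_mul.
  exact: has_charM.
by exists (Group pG) => a; rewrite inE; apply: pP.
Qed.

Lemma char_expd (a : Ch) : (a ^+ d = 1)%g.
Proof.
rewrite FinRing.zmodXgE FinRing.zmod1gE; apply/rowP => i.
by apply/val_inj; rewrite mulmxnE mxE Zp_mulrn /= modnMl.
Qed.

(** * Commutativity, exponent and order of $Z_d(H)$ *)

Lemma Zd_abelianP : Zd_abelian d H.
Proof.
move=> g g' Zg Zg'; have [[gSL _] [g'SL _]] := (Zg, Zg').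
have [[a ag] [b bg']] := (has_char_exists _ Zg, has_char_exists _ Zg').
have [||||c _ E] := same_char (a * b)%g (g *m g') (g' *m g).
- by case: (in_Zd_mul _ _ Zg Zg').
- by case: (in_Zd_mul _ _ Zg' Zg).
- exact: has_charM.
- have -> : (a * b = b * a)%g by rewrite !FinRing.zmodMgE addrC.
  exact: has_charM.
(* So far only $c^n = 1$ is known. Since [g ^+ d] has trivial character it is scalar, and moving
   [g'] across it yields $c^d = 1$. *)
exists c; split=> //.
have [ug ug'] := (inSL_unitmx _ gSL, inSL_unitmx _ g'SL).
have gX k : g ^+ k *m g' = c ^+ k *: (g' *m g ^+ k).
  elim: k => [|k IH]; first by rewrite !expr0 scale1r mulmx1 mul1mx.
  rewrite [g ^+ _]exprSr -[g ^+ k * g]/(g ^+ k *m g) -[LHS]mulmxA E.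
  rewrite -scalemxAr (mulmxA (g ^+ k)) IH.
  by rewrite -scalemxAl scalerA -exprS -mulmxA.
have [l El] : exists l, g ^+ d = l%:M.
  apply/schur/hs_test => i; rewrite (has_charX _ _ d ag) char_expd.
  by rewrite FinRing.zmod1gE mxE /= scale1r.
have := gX d; rewrite El mul_scalar_mx mul_mx_scalar scalerA.
have l0 : l != 0.
  have : g ^+ d != 0.
    apply: unitmx_neq0 => //; elim: (d) => [|k IH]; first by rewrite unitmx1.
    by rewrite exprS unitmx_mul ug.
  by rewrite El; apply: contraNneq => ->; rewrite raddf0.
move/(scaler_cancel _ _ _ _ _ (unitmx_neq0 _ _ _ n_gt0 ug'))/esym.
by rewrite -[RHS]mul1r => /(mulIf l0).
Qed.

Lemma Zd_exponentP : (d %| n)%N -> Zd_exponent_dvd d H (lcmn (n %/ d) d).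
Proof.
move=> dn g Zg; have [gSL _] := Zg; have [a ag] := has_char_exists _ Zg.
have ug := inSL_unitmx _ gSL.
set k := #[a]%g; have k0 : (0 < k)%N := order_gt0 a.
have kd : (k %| d)%N by rewrite order_dvdn char_expd.
have [v gk] : exists v, g ^+ k = v%:M.
  apply/schur/hs_test => i; rewrite (has_charX _ _ k ag) expg_order.
  by rewrite FinRing.zmod1gE mxE /= scale1r.
(* A nonzero coefficient in degree [j] makes the [j]-th power of every character value 1, so [k]
   divides [j]. *)
have [kn] : (k %| n)%N /\ (-1) ^+ n * \det g = (- v) ^+ (n %/ k).
  apply: det_of_scalar_power => // j pj; rewrite order_dvdn.
  apply/eqP; rewrite FinRing.zmodXgE FinRing.zmod1gE; apply/rowP => i.
  have uh := inSL_unitmx _ (H_inSL _ (hsH i)).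
  have /eqP := char_poly_coef_twist _ _ _ _ _ _ ug uh (ag i) pj.
  rewrite -exprM -(prim_order_dvd zP) mulmxnE mxE => dij.
  by apply/val_inj; rewrite /= Zp_mulrn /=; apply/eqP.
rewrite gSL mulr1 [RHS]exprNn => det1.
have vnk : v ^+ (n %/ k) = (-1) ^+ (n + n %/ k).
  by rewrite exprD det1 mulrAC -exprD addnn -mul2n exprM sqrrN !expr1n mul1r.
have kL : (k %| lcmn (n %/ d) d)%N := dvdn_trans kd (dvdn_lcmr _ _).
(* With $L$ the lcm, $g^L = v^{L/k}$. Its [d]-th power is a power of $v^{n/k} = \pm 1$ by [Lk], and
   the sign is trivial by [lcm_parity]. *)
exists (v ^+ (lcmn (n %/ d) d %/ k)); split; last first.
  rewrite -{1}(divnK kL) mulnC exprM gk.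
  elim: (_ %/ k)%N => [|j IH]; first by rewrite !expr0 scale1r.
  by rewrite !exprS IH -[_ * _]/(_ *m _) mul_scalar_mx scalerA.
have Lk : (lcmn (n %/ d) d %/ k * d =
           n %/ k * (d %/ gcdn (n %/ d) d))%N.
  have g0 : (0 < gcdn (n %/ d) d)%N by rewrite gcdn_gt0 orbT.
  apply/eqP; rewrite -(eqn_pmul2r k0) -(eqn_pmul2r g0) ![(_ * _ * k)%N]mulnAC.
  rewrite !divnK // [(_ * d * _)%N]mulnAC muln_lcm_gcd divnK // -mulnA.
  by rewrite divnK ?dvdn_gcdr.
rewrite -exprM Lk exprM vnk -exprM -signr_odd.
by rewrite (negbTE (lcm_parity _ _ _ dn kd n_gt0)).
Qed.

Lemma Zd_orderP : (d %| n)%N -> exists m : nat,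
    [/\ Zd_order d H m,
        (m %| n ^ 3 %/ d)%N &
        (coprime (n %/ d) d -> (m %| n * d)%N)].
Proof.
move=> dn; have [A AP] := char_group_exists.
have /fin_all_exists [s sP] (a : Ch) :
    exists g, a \in A -> in_Zd d H g /\ has_char a g.
  case aA: (a \in A); last by exists 0.
  by have [g Zg ag] := (AP a).1 aA; exists g.
have sZ a : a \in A -> in_Zd d H (s a) by case/sP.
have sSL a : a \in A -> inSL (s a) by case/sZ.
have sC a : a \in A -> has_char a (s a) by case/sP.
have An2 : (#|A| %| n ^ 2)%N.
  apply: (proj_repr_card_dvd C n Ch s n_gt0); first split.
  - by move=> a aA; apply/inSL_unitmx/sSL.
  - move=> a b aA bA; have abA := groupM aA bA.
    have [||||c _ ->] := same_char (a * b)%g (s (a * b)%g) (s a *m s b).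
    + exact: sSL.
    + by case: (in_Zd_mul _ _ (sZ a aA) (sZ b bA)).
    + exact: sC.
    + by apply: has_charM; apply: sC.
    by exists c.
  - move=> a aA a1.
    have [i ai] : exists i, a 0 i != 0.
      apply/existsP; apply: contraNT a1; rewrite negb_exists => /forallP a0.
      apply/eqP/rowP => i; rewrite FinRing.zmod1gE mxE.
      by move: (a0 i); rewrite negbK => /eqP.
    have uh := inSL_unitmx _ (H_inSL _ (hsH i)).
    (* [s a] is $z^{a_i}$ times a conjugate of itself, and $z^{a_i} \neq 1$, so its trace is 0. *)
    have : \tr (s a) = z ^+ a 0 i * \tr (s a).
      rewrite -{1}(mulmxK uh (s a)) (sC a aA i) -scalemxAl mxtraceZ.
      by rewrite mxtrace_mulC mulKmx.
    move/eqP; rewrite -subr_eq0 -{1}[\tr _]mul1r -mulrBl mulf_eq0 subr_eq0.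
    rewrite eq_sym -(prim_order_dvd zP) => /orP[|/eqP//].
    by rewrite gtnNdvd // lt0n.
  - move=> a b aA bA.
    have [||||c _ ->] := same_char (a * b)%g (s a *m s b) (s b *m s a).
    + by case: (in_Zd_mul _ _ (sZ a aA) (sZ b bA)).
    + by case: (in_Zd_mul _ _ (sZ b bA) (sZ a aA)).
    + by apply: has_charM; apply: sC.
    + have -> : (a * b = b * a)%g by rewrite !FinRing.zmodMgE addrC.
      by apply: has_charM; apply: sC.
    by exists c.
have [w wP] := prim_root_exists C n n_gt0.
set e := (n %/ d)%N; have En : n = (e * d)%N by rewrite divnK.
have e0 : (0 < e)%N by move: n_gt0; rewrite En muln_gt0 => /andP[].
exists (#|A| * e)%N; split.
(* Representatives are $w^j s(a)$ with $j < e$: the scalars in $SL(n)$ are the powers of [w], and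
   $w^e$ generates the [d]-th roots of unity. *)
- pose l := [seq (a, j) | a <- enum A, j <- iota 0 e].
  pose F (x : Ch * nat) := w ^+ x.2 *: s x.1.
  have lP x : x \in l -> x.1 \in A /\ (x.2 < e)%N.
    by case/allpairsP => -[a j] /= [+ + ->]; rewrite mem_enum mem_iota.
  have lu : uniq l.
    by apply: allpairs_uniq; rewrite ?enum_uniq ?iota_uniq // => -[? ?] [].
  have wn j : (w ^+ j) ^+ n = 1.
    by rewrite exprAC (prim_expr_order wP) expr1n.
  exists (map F l); split.
  + by rewrite size_map size_allpairs -cardE size_iota.
  + move=> _ /mapP[x /lP[xA _] ->]; apply: in_Zd_scale => //; exact: sZ.
  + rewrite size_map => i j il jl.
    rewrite !(nth_map (1%g, 0%N)) // => -[c [cd E]].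
    apply/eqP; rewrite -(nth_uniq (1%g, 0%N) il jl lu); apply/eqP.
    move: (mem_nth (1%g, 0%N) il) (mem_nth (1%g, 0%N) jl) E.
    case: (nth _ l i) => a k; case: (nth _ l j) => b k'.
    move=> /lP[/= aA ke] /lP[/= bA k'e]; rewrite /F /= => E.
    have ab : a = b.
      apply: (has_char_unique _ _ (w ^+ k *: s a)).
      * by case: (in_Zd_scale _ _ (wn k) (sZ a aA)).
      * exact/has_charZ/sC.
      * by rewrite E; do 2 apply: has_charZ; apply: sC.
    rewrite -ab in E *; congr (_, _).
    move: E; rewrite scalerA.
    have ua := inSL_unitmx _ (sSL a aA).
    move/(scaler_cancel _ _ _ _ _ (unitmx_neq0 _ _ _ n_gt0 ua)).
    (* Raising to the power [d] removes [c] and leaves $kd \equiv k'd$ modulo $n = ed$. *)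
    move/(congr1 (fun x => x ^+ d)); rewrite exprMn cd mul1r -!exprM.
    move/eqP; rewrite (eq_prim_root_expr wP) En -!muln_modl.
    rewrite eqn_pmul2r // !modn_small // => /eqP; exact.
  + move=> g Zg; have [a ag] := has_char_exists _ Zg.
    have aA : a \in A by apply/AP; exists g.
    have [c cn E] := same_char _ _ _ (proj1 Zg) (sSL a aA) ag (sC a aA).
    have [i ci] := prim_rootP wP cn.
    exists (F (a, (i %% e)%N)).
      apply: map_f; apply/allpairsP; exists (a, (i %% e)%N).
      by rewrite mem_enum mem_iota ltn_mod.
    (* Divide [i] by [e]: the multiple of [e] contributes a [d]-th root of unity, the remainder
       selects the representative. *)
    exists (w ^+ (i %/ e * e)); split.
      rewrite -exprM -mulnA -En mulnC exprM (prim_expr_order wP).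
      by rewrite expr1n.
    by rewrite /F scalerA -exprD -divn_eq -ci.
- have -> : (n ^ 3 %/ d = n ^ 2 * e)%N by rewrite expnSr -muln_divA.
  by rewrite dvdn_mul.
(* $|A|$ divides $|Ch| = d^r$, so it is prime to [e]; from $n^2 = e^2 d^2$ it then divides $d^2$,
   and $nd = d^2 e$. *)
- move=> co; have cA : coprime #|A| e.
    have : (#|A| %| #|[set: Ch]|)%N by apply: cardSg; apply: subsetT.
    rewrite cardsT card_mx card_ord mul1n => /coprime_dvdl; apply.
    by rewrite coprimeXl // coprime_sym.
  have Ad : (#|A| %| d ^ 2)%N.
    by move: An2; rewrite {1}En expnMn Gauss_dvdr // coprimeXr.
  have -> : (n * d = d ^ 2 * e)%N by rewrite {1}En -mulnA mulnC.
  by rewrite dvdn_mul.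
Qed.

End Centralizer.

Theorem mainTheorem18 (C : numClosedFieldType) (n d : nat)
  (H : 'M[C]_n -> Prop)
  (hn : (0 < n)%N) (hd : (d %| n)%N)
  (hH : is_subgroup_SL H) (hirr : irreducible_SL H) :
  Zd_abelian d H /\
  Zd_exponent_dvd d H (lcmn (n %/ d) d) /\
  exists m : nat,
    [/\ Zd_order d H m,
        (m %| n ^ 3 %/ d)%N &
        (coprime (n %/ d) d -> (m %| n * d)%N)].
Proof.
(* The value [d = 0] is excluded, since 0 divides only 0. *)
case: d hd => [|d] hd; first by move: hd hn; rewrite dvd0n lt0n => ->.
have [r [hs [hsH hs_test]]] := finite_test_set C n H.
have [z zP] := prim_root_exists C d.+1 (ltn0Sn d).
split; first exact: (Zd_abelianP C n d H hn hH hirr z r hs).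
split; first exact: (Zd_exponentP C n d H hn hH hirr z r hs).
exact: (Zd_orderP C n d H hn hH hirr z r hs).
Qed.
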